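(* Let $D\subset\mathbb{R}^d$ be a design with $n$ distinct points and let $w\in\mathbb{R}^d_{>0}$ be a weight vector. Then there is at least one vertex $\alpha^*$ of the state polytope $S(D)$ which minimises $A(w,L)$ over all identifiable staircase models $\mathcal{L}_s(D)$, that is, $$\frac{1}{n}\,w^T\alpha^* \;=\; A(w,L^* )\;=\;\min_{L\in\mathcal{L}_s(D)}A(w,L)$$ for all $L^*$ with $\overline{\alpha}_{L^*}=\alpha^*$. Moreover, given any vertex $\overline{\alpha}_{\overline{L}}$ of $S(D)$ (with $\overline L\in\mathcal L_a(D)$), there is at least one $w^*\in\mathbb{R}^d_{>0}$ such that this vertex (model) minimises the aberration for $w^*$, that is, $A(w^*,\overline{L})=\min_{L\in\mathcal{L}_a(D)}A(w^*,L)$.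
   Context: A design $D\subset\mathbb{R}^d$ is a finite set of $n=|D|$ points. A monomial is $x^\alpha=x_1^{\alpha_1}\cdots x_d^{\alpha_d}$ with $\alpha\in\mathbb{Z}_{\ge0}^d$. A model basis is a finite set $L\subset\mathbb{Z}^d_{\ge 0}$ of exponents; it is identifiable by $D$ if $|L|=n$ and the matrix $[x^\alpha]_{x\in D,\alpha\in L}$ is invertible. $L$ is a staircase if $\alpha\in L$ and $\beta\le\alpha$ componentwise imply $\beta\in L$. $\mathcal{L}_s(D)$ denotes the set of all staircases identifiable by $D$. For a weight vector $w$ and a model basis $L$ with $|L|=n$, the (weighted linear) aberration is $A(w,L)=\frac{1}{n}\sum_{\alpha\in L}\sum_{i=1}^d w_i\alpha_i=\frac1n w^T\overline{\alpha}_L$, where $\overline{\alpha}_L=\sum_{\alpha\in L}\alpha$. The design ideal $I(D)$ is the ideal of all real polynomials vanishing on $D$. For a term ordering $\succ$ on monomials, $L(D,\succ)$ is the set of exponents of monomials not divisible by any leading term (w.r.t. $\succ$) of an element of $I(D)$ (equivalently of a Gröbner basis of $I(D)$); it is an identifiable staircase. The algebraic fan is $\mathcal{L}_a(D)=\{L(D,\succ):\succ \text{ a term ordering}\}$, and the state polytope is $S(D)=\mathrm{conv}\{\overline{\alpha}_L: L\in\mathcal{L}_a(D)\}$. *)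

(* Defs.v *)
From HB Require Import structures.
From mathcomp Require Import all_boot all_order all_algebra.
From mathcomp Require Import finmap.
From mathcomp Require Import reals.
From mathcomp Require Import mpoly.
Set Implicit Arguments. Unset Strict Implicit. Unset Printing Implicit Defensive.
Import Order.TTheory GRing.Theory Num.Theory.
Local Open Scope ring_scope.


Section Design.
Variables (R : realType) (d : nat).

(* A design is a duplicate-free list of points of R^d (row vectors). *)
Definition design := seq 'rV[R]_d.

Definition expo := 'X_{1..d}.

Definition monom_at (x : 'rV[R]_d) (a : expo) : R :=
  \prod_(i < d) (x 0 i) ^+ (a i).

Definition exp_le (b a : expo) : bool := [forall i, (b i <= a i)%N].

Definition model := {fset expo}.

Definition staircase (L : model) : Prop :=
  forall a b : expo, a \in L -> exp_le b a -> b \in L.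

(* design/model matrix [x^alpha]_{x in D, alpha in L} (with |L| = |D|) *)
Definition design_matrix (D : design) (L : model) : 'M[R]_(size D) :=
  \matrix_(i < size D, j < size D)
     monom_at (nth 0 D i) (nth 0%MM (enum_fset L) j).

Definition identifiable (D : design) (L : model) : Prop :=
  #|` L| = size D /\ \det (design_matrix D L) != 0.

Definition Ls (D : design) (L : model) : Prop :=
  staircase L /\ identifiable D L.

Definition in_design_ideal (D : design) (p : {mpoly R[d]}) : Prop :=
  forall x, x \in D -> p.@[fun i => x 0 i] = 0.

Definition term_ordering (gt : expo -> expo -> bool) : Prop :=
  [/\ (forall a, ~~ gt a a),
      (forall a b c, gt a b -> gt b c -> gt a c),
      (forall a b, a != b -> gt a b || gt b a),
      (forall a b c, gt a b -> gt (a + c)%MM (b + c)%MM) &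
      (forall a, a != 0%MM -> gt a 0%MM)].

Definition is_lead (gt : expo -> expo -> bool) (p : {mpoly R[d]}) (m : expo) : Prop :=
  m \in msupp p /\ forall m', m' \in msupp p -> m' != m -> gt m m'.

Definition in_LD (D : design) (gt : expo -> expo -> bool) (a : expo) : Prop :=
  ~ exists p m, [/\ in_design_ideal D p, p != 0, is_lead gt p m & exp_le m a].

Definition La (D : design) (L : model) : Prop :=
  exists gt, term_ordering gt /\ forall a, a \in L <-> in_LD D gt a.

Definition alphabar (L : model) : 'rV[R]_d :=
  \row_(i < d) \sum_(a <- enum_fset L) ((a i)%:R : R).

Definition aberration (D : design) (w : 'rV[R]_d) (L : model) : R :=
  (size D)%:R^-1 * \sum_(a <- enum_fset L) \sum_(i < d) w 0 i * (a i)%:R.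

Definition conv (P : 'rV[R]_d -> Prop) (v : 'rV[R]_d) : Prop :=
  exists (s : seq 'rV[R]_d) (t : seq R),
    [/\ size t = size s, (forall x, x \in s -> P x),
        (forall c, c \in t -> 0 <= c), \sum_(c <- t) c = 1 &
        v = \sum_(k < size s) t`_k *: s`_k].

Definition state_polytope (D : design) (v : 'rV[R]_d) : Prop :=
  conv (fun u => exists L, La D L /\ u = alphabar L) v.

Definition vertex (K : 'rV[R]_d -> Prop) (v : 'rV[R]_d) : Prop :=
  K v /\ forall x y (t : R), K x -> K y -> 0 < t < 1 ->
     v = t *: x + (1 - t) *: y -> x = v /\ y = v.

Definition pos_weight (w : 'rV[R]_d) : Prop := forall i, 0 < w 0 i.

Definition wdot (w v : 'rV[R]_d) : R := \sum_(i < d) w 0 i * v 0 i.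

End Design.

(* Main.v *)
Require Import Defs.
From HB Require Import structures.
From mathcomp Require Import all_boot all_order all_algebra perm.
From mathcomp Require Import finmap.
From mathcomp Require Import boolp reals.
From mathcomp Require Import mpoly.
From mathcomp Require Import ring lra zify.
Set Implicit Arguments. Unset Strict Implicit. Unset Printing Implicit Defensive.
Import Order.TTheory GRing.Theory Num.Theory.
Local Open Scope ring_scope.

(** For a term ordering [gt], the standard monomials L = L(D, gt) form a basis
    of the functions on D, and the normal form of a monomial involves only
    standard monomials below it. Hence for an identifiable M the base change
    from L to M is an invertible matrix, and a nonzero term of its determinant
    matches each monomial of L with a monomial of M that is at least as large:
    L minimises every weight that is monotone for [gt]. Refining [w] to a term
    ordering gives a minimiser of the [w]-aberration. On the finitely many
    monomials of bounded degree, any term ordering is represented by a strictly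
    monotone positive weight (Gordan's alternative); for this weight L is the
    unique minimiser over the algebraic fan, so that its point is a vertex. *)

(** * Gordan's alternative for integer vectors *)

Section SeparatingWeight.
Variables (R : realType) (d : nat).

(** Supplies the value of an eliminated coordinate from its lower and upper bounds, either of which
    may be absent. *)
Lemma between_finite_seqs (A B : seq R) :
  (forall a b, a \in A -> b \in B -> a < b) ->
  exists x, (forall a, a \in A -> a < x) /\ (forall b, b \in B -> x < b).
Proof.
elim: A => [|a A IH] AB.
  elim: B {AB} => [|b B [x [_ xB]]]; first by exists 0.
  exists (Num.min x (b - 1)); split=> // c; rewrite inE => /orP[/eqP->|/xB xc].
    by rewrite gt_min; apply/orP; right; lra.
  by rewrite gt_min xc.
case: IH => [b c bA cB|x [xA xB]]; first by apply: AB => //; rewrite inE bA orbT.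
have [ax|xa] := ltP a x.
  by exists x; split=> // b; rewrite inE => /orP[/eqP->|/xA].
have {AB} : forall b, b \in B -> a < b by move=> b; apply: AB; rewrite mem_head.
(* Any such [y] exceeds [x] too, since [x <= a], hence everything in [A]. *)
move=> aB; have [y ay yB] : exists2 y, a < y & forall b, b \in B -> y < b.
  elim: (B) aB => [|b B' IH] aB; first by exists (a + 1) => //; lra.
  case: IH => [c cB|y ay yB]; first by apply: aB; rewrite inE cB orbT.
  have ab : a < b by apply: aB; rewrite mem_head.
  exists (Num.min y ((a + b) / 2)) => [|c]; first by rewrite lt_min ay /=; lra.
  by rewrite inE gt_min => /orP[/eqP->|/yB->] //; apply/orP; right; lra.
by exists y; split=> // b; rewrite inE => /orP[/eqP->|/xA bx] //; lra.
Qed.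

(** Differences of exponents are integer vectors, while the weights are real. *)
Definition idot (w : 'rV[R]_d) (v : 'rV[int]_d) : R :=
  \sum_(i < d) w 0 i * (v 0 i)%:~R.

Lemma idotD w u v : idot w (u + v) = idot w u + idot w v.
Proof.
by rewrite /idot -big_split; apply: eq_bigr => i _; rewrite mxE rmorphD mulrDr.
Qed.

Lemma idotMn w u n : idot w (u *+ n) = idot w u *+ n.
Proof.
elim: n => [|n IH]; last by rewrite !mulrS idotD IH.
by rewrite /idot big1 // => i _; rewrite mxE mulr0.
Qed.

(* Fourier-Motzkin elimination of one coordinate at a time: pairs of vectors of
   opposite sign at coordinate [k] are combined into one vanishing there. *)
Lemma separating_weight_trunc (C : 'rV[int]_d -> Prop) (k : nat) :
  (forall u v, C u -> C v -> C (u + v)) -> ~ C 0 -> (k <= d)%N ->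
  forall V : seq 'rV[int]_d, (forall v, v \in V -> C v) ->
  (forall v (i : 'I_d), v \in V -> (k <= i)%N -> v 0 i = 0) ->
  exists w : 'rV[R]_d, forall v, v \in V -> 0 < idot w v.
Proof.
move=> CD C0.
have CM n u : C u -> C (u *+ n.+1).
  by move=> Cu; elim: n => [|n IH] //; rewrite mulrS; apply: CD.
elim: k => [|k IH] kd V CV V0.
  (* With all coordinates zero, a member of [V] would be the zero vector, which [C] omits; so [V] is
     empty. *)
  exists 0 => v vV; case: C0; have <- : v = 0; last exact: CV.
  by apply/rowP => i; rewrite mxE V0.
pose o := Ordinal kd.
pose comb (u v : 'rV[int]_d) := u *+ absz (v 0 o) + v *+ absz (u 0 o).
pose Vp := [seq v : 'rV[int]_d <- V | 0 < v 0 o]; pose Vn := [seq v : 'rV[int]_d <- V | v 0 o < 0].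
pose V' := [seq v : 'rV[int]_d <- V | v 0 o == 0] ++ [seq comb u v | u <- Vp, v <- Vn].
have CMz (z : int) u : z != 0 -> C u -> C (u *+ `|z|%N).
  by rewrite -absz_gt0; case: `|z|%N => // n _; apply: CM.
have [w' w'P] : exists w : 'rV[R]_d, forall v, v \in V' -> 0 < idot w v.
  apply: IH => [|v|v i]; first exact: ltnW.
    rewrite mem_cat => /orP[|/allpairsP[[u1 u2] /= []]].
      by rewrite mem_filter => /andP[_ /CV].
    rewrite !mem_filter => /andP[u1p /CV C1] /andP[u2n /CV C2] ->.
    by apply: CD; apply: CMz; rewrite // ?(lt_eqF u2n) ?(gt_eqF u1p).
  rewrite mem_cat => /orP[|/allpairsP[[u1 u2] /= []]].
    rewrite mem_filter => /andP[/eqP v0 vV]; rewrite leq_eqVlt => /orP[/eqP ki|].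
      by rewrite (_ : i = o) //; apply: val_inj.
    exact: V0.
  rewrite !mem_filter => /andP[u1p V1] /andP[u2n V2] ->.
  rewrite leq_eqVlt => /orP[/eqP ki|ki]; last first.
    by rewrite mxE !mulmxnE (V0 _ _ V1 ki) (V0 _ _ V2 ki) !mul0rn addr0.
  have {ki}-> : i = o by apply: val_inj.
  rewrite mxE !mulmxnE; move: u1p u2n.
  set a := u1 0 o; set b := u2 0 o => a0 b0.
  rewrite -[a *+ _]mulr_natr -[b *+ _]mulr_natr !natz !abszE.
  by rewrite (gtr0_norm a0) (ltr0_norm b0); ring.
pose f (v : 'rV[int]_d) : R := \sum_(i < d | i != o) w' 0 i * (v 0 i)%:~R.
pose c (v : 'rV[int]_d) : R := (v 0 o)%:~R.
(* Positivity of [x * c v + f v] bounds the new weight [x] below by [- f v / c v] on [Vp] and above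
   on [Vn]. Positivity of [w'] on [comb u v] says that each lower bound is less than each upper
   bound. *)
have [x [xp xn]] : exists x,
   (forall a, a \in [seq - f v / c v | v <- Vp] -> a < x) /\
   (forall b, b \in [seq - f v / c v | v <- Vn] -> x < b).
  apply: between_finite_seqs => _ _ /mapP[u uV ->] /mapP[v vV ->].
  have := w'P (comb u v); rewrite mem_cat => /(_ _)/wrap[].
    by apply/orP; right; apply/allpairsP; exists (u, v).
  have idotE z : idot w' z = w' 0 o * c z + f z by rewrite /idot (bigD1 o).
  rewrite idotD !idotMn !idotE.
  move: uV vV; rewrite !mem_filter => /andP[u0 _] /andP[v0 _].
  have cu : 0 < c u by rewrite ltr0z.
  have cv : c v < 0 by rewrite ltrz0.
  have au : (absz (u 0 o))%:R = c u by rewrite pmulrn abszE gtr0_norm.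
  have av : (absz (v 0 o))%:R = - c v.
    by rewrite pmulrn abszE ltr0_norm // rmorphN.
  rewrite -mulr_natr -[X in _ + X]mulr_natr au av => H.
  rewrite ltr_pdivrMr // mulrAC ltr_ndivlMr //; nra.
exists (\row_i if i == o then x else w' 0 i) => v vV.
have -> : idot (\row_i (if i == o then x else w' 0 i)) v = x * c v + f v.
  rewrite /idot (bigD1 o) //= mxE eqxx; congr (_ + _).
  by apply: eq_bigr => i /negPf io; rewrite mxE io.
have [v0|v0|v0] := ltgtP (v 0 o) 0.
- have cv : c v < 0 by rewrite ltrz0.
  have vVn : v \in Vn by rewrite mem_filter v0.
  have := xn _ (map_f (fun v => - f v / c v) vVn).
  by rewrite ltr_ndivlMr // => H; lra.
- have cv : 0 < c v by rewrite ltr0z.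
  have vVp : v \in Vp by rewrite mem_filter v0.
  have := xp _ (map_f (fun v => - f v / c v) vVp).
  by rewrite ltr_pdivrMr // => H; lra.
- have := w'P v; rewrite mem_cat mem_filter v0 eqxx vV => /(_ isT).
  by rewrite /idot (bigD1 o) //= /c v0 !mulr0 !add0r.
Qed.

(** The absence of a positive relation among the vectors of [V] is expressed by an additive set [C]
    that contains them and omits zero. *)
Lemma separating_weight (C : 'rV[int]_d -> Prop) (V : seq 'rV[int]_d) :
  (forall u v, C u -> C v -> C (u + v)) -> ~ C 0 ->
  (forall v, v \in V -> C v) ->
  exists w : 'rV[R]_d, forall v, v \in V -> 0 < idot w v.
Proof.
move=> CD C0 CV; apply: (separating_weight_trunc CD C0 (leqnn d)) => // v i _.
by rewrite leqNgt ltn_ord.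
Qed.

End SeparatingWeight.

(** * Normal forms modulo the design ideal *)

Section Reduction.
Variables (R : realType) (d : nat) (D : design R d).
Implicit Types (p q s : {mpoly R[d]}) (P Q : expo d -> Prop).

Lemma design_idealD p q :
  in_design_ideal D p -> in_design_ideal D q -> in_design_ideal D (p + q).
Proof. by move=> Ip Iq x xD; rewrite mevalD Ip ?Iq ?addr0. Qed.

Lemma design_idealM p q : in_design_ideal D p -> in_design_ideal D (p * q).
Proof. by move=> Ip x xD; rewrite mevalM Ip ?mul0r. Qed.

Lemma design_idealZ c p : in_design_ideal D p -> in_design_ideal D (c *: p).
Proof. by move=> Ip x xD; rewrite mevalZ Ip ?mulr0. Qed.

Definition supported P s := forall m, m \in msupp s -> P m.

Lemma supported0 P : supported P 0.
Proof. by move=> m; rewrite msupp0. Qed.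

Lemma supportedD P p q : supported P p -> supported P q -> supported P (p + q).
Proof. by move=> Pp Pq m /msuppD_le; rewrite mem_cat => /orP[/Pp|/Pq]. Qed.

Lemma supportedZ P c p : supported P p -> supported P (c *: p).
Proof. by move=> Pp m /msuppZ_le /Pp. Qed.

Lemma supportedX P m : P m -> supported P 'X_[m].
Proof. by move=> Pm m' /mem_msuppXP <-. Qed.

(** Rewriting modulo the ideal is a mere existence statement, so reductions compose through
    [reduces_trans]. *)
Definition reduces P p :=
  exists2 s, in_design_ideal D (p - s) & supported P s.

Lemma reduces_supported P p : supported P p -> reduces P p.
Proof. by move=> Pp; exists p => // x _; rewrite subrr meval0. Qed.

Lemma reducesD P p q : reduces P p -> reduces P q -> reduces P (p + q).
Proof.
move=> [s Is Ps] [t It Pt]; exists (s + t); last exact: supportedD.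
by rewrite opprD addrACA; apply: design_idealD.
Qed.

Lemma reducesZ P c p : reduces P p -> reduces P (c *: p).
Proof.
move=> [s Is Ps]; exists (c *: s); last exact: supportedZ.
by rewrite -scalerBr; apply: design_idealZ.
Qed.

Lemma reduces_monomials P p :
  supported (fun m => reduces P 'X_[m]) p -> reduces P p.
Proof.
move=> H; rewrite [p]mpolyE big_seq; elim/big_ind: _ => [|q r|m /H].
- apply: reduces_supported; exact: supported0.
- exact: reducesD.
- exact: reducesZ.
Qed.

Lemma reduces_trans P Q p :
  reduces P p -> (forall m, P m -> reduces Q 'X_[m]) -> reduces Q p.
Proof.
move=> [s Is Ps] PQ; have [t It Qt] : reduces Q s.
  by apply: reduces_monomials => m /Ps /PQ.
exists t => //; rewrite -(subrKA s); exact: design_idealD.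
Qed.

Lemma reduces_weaken P Q p :
  (forall m, P m -> Q m) -> reduces P p -> reduces Q p.
Proof. by move=> PQ [s Is Ps]; exists s => // m /Ps /PQ. Qed.

Lemma exp_leEsub (a b : expo d) : exp_le b a -> (a - b + b)%MM = a.
Proof. by move=> /submK. Qed.

Lemma exp_le_refl (a : expo d) : exp_le a a.
Proof. by apply/forallP. Qed.

Lemma exp_le_trans (a b c : expo d) : exp_le a b -> exp_le b c -> exp_le a c.
Proof.
by move=> /forallP ab /forallP bc; apply/forallP => i; apply: leq_trans (bc i).
Qed.

Variable gt : expo d -> expo d -> bool.
Hypothesis gtP : term_ordering gt.

Let gt_irr a : gt a a = false.
Proof. by case: gtP => /(_ a)/negPf. Qed.

Lemma gt_addl (c m : expo d) : c != 0%MM -> gt (c + m)%MM m.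
Proof.
case: gtP => _ _ _ gtD gt0 /gt0 c0.
by have := gtD _ _ m c0; rewrite add0m.
Qed.

(** A leading monomial [m] of an ideal element divides [a]; the multiple of that element by
    ['X_[a - m]], scaled to be monic, cancels ['X_[a]] and leaves smaller monomials. *)
Lemma not_in_LD_reduces a : ~ in_LD D gt a -> reduces (gt a) 'X_[a].
Proof.
case: gtP => _ _ _ gtD _ /contrapT[p [m [Ip p0 [mp lead] ma]]].
have c0 : p@_m != 0 by rewrite -mcoeff_msupp.
pose q := (p@_m)^-1 *: (p * 'X_[a - m]).
exists ('X_[a] - q) => [|m' m's].
  by rewrite subKr; apply/design_idealZ/design_idealM.
have am' : m' != a.
  apply: contraTneq m's => ->; rewrite mcoeff_msupp mcoeffB mcoeffX eqxx mcoeffZ.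
  have -> : (p * 'X_[a - m])@_a = p@_m.
    by rewrite -[X in _@_X = _](exp_leEsub ma) mcoeffMX.
  by rewrite mulVf // subrr eqxx.
move/msuppB_le: m's; rewrite mem_cat msuppX inE (negPf am') /=.
move=> /msuppZ_le; rewrite (perm_mem (msuppMX _ _)) => /mapP[m2 m2p m'E].
rewrite m'E -{1}(exp_leEsub ma) ![((a - m) + _)%MM]addmC; apply/gtD/lead => //.
by apply: contra_neq am' => m2E; rewrite m'E m2E exp_leEsub.
Qed.

(** The difference of ['X_[a]] and its reduction is an ideal element with leading monomial [a]. *)
Lemma in_LD_irreducible a : reduces (gt a) 'X_[a] -> ~ in_LD D gt a.
Proof.
move=> [s Is Ps]; apply; exists ('X_[a] - s), a.
have sa : s@_a = 0.
  by apply: memN_msupp_eq0; apply/negP => /Ps; rewrite gt_irr.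
have pa : a \in msupp ('X_[a] - s).
  by rewrite mcoeff_msupp mcoeffB mcoeffX eqxx sa subr0 oner_eq0.
split=> //; last exact: exp_le_refl.
  by apply: contraTneq pa => ->; rewrite msupp0.
split=> // m /msuppB_le; rewrite mem_cat msuppX inE => /orP[->//|/Ps //].
Qed.

Lemma in_LD_down a b : in_LD D gt a -> exp_le b a -> in_LD D gt b.
Proof.
move=> Ha ba [p [m [Ip p0 lead mb]]]; apply: Ha; exists p, m; split=> //.
exact: exp_le_trans ba.
Qed.

(* Uses the element \prod_(x in D) ('X_i - x_i) of the ideal, which involves
   only powers of 'X_i. *)
Lemma large_coord_reduces (a : expo d) (i : 'I_d) : (size D <= a i)%N ->
  reduces (fun m => gt a m /\ (mdeg m < mdeg a)%N) 'X_[a].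
Proof.
move=> na; pose n := size D; pose b := (a - U_(i) *+ n)%MM.
have ab : a = (b + U_(i) *+ n)%MM.
  rewrite submK //; apply/forallP => j; rewrite mulmnE mnm1E.
  by case: eqP => [<-|_]; rewrite ?mul1n ?mul0n.
pose q : {poly R} := \prod_(x <- D) ('X - (x 0 i)%:P).
(* As [q] is monic of degree [n], ['X_[a]] minus this witness evaluates to ['X_[b]] times [q] at the
   coordinate [i]. *)
exists (- \sum_(k < n) q`_k *: 'X_[b + U_(i) *+ k]) => [x xD|].
  have q0 : q.[x 0 i] = 0.
    by rewrite /q horner_prod (big_rem x) //= hornerXsubC subrr mul0r.
  have mE k : ('X_[b + U_(i) *+ k] : {mpoly R[d]}).@[fun i => x 0 i] =
      ('X_[b] : {mpoly R[d]}).@[fun i => x 0 i] * x 0 i ^+ k.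
    by rewrite mpolyXD mevalM -mpolyXn rmorphXn /= mevalXU.
  rewrite opprK {1}ab mevalD mE raddf_sum /=.
  under eq_bigr => k _ do rewrite mevalZ mE mulrCA.
  rewrite -mulr_sumr -mulrDr; apply/eqP; rewrite mulf_eq0; apply/orP; right.
  apply/eqP; rewrite -[RHS]q0 horner_coef size_prod_XsubC big_ord_recr /= addrC; congr (_ + _).
  have := monic_prod_XsubC D xpredT (fun x : 'rV[R]_d => x 0 i).
  rewrite -/q monicE lead_coefE size_prod_XsubC /= => /eqP->.
  by rewrite mul1r.
rewrite -scaleN1r; apply: supportedZ; elim/big_ind: _ => [||k _].
- exact: supported0.
- exact: supportedD.
apply: supportedZ; apply: supportedX; have kn := ltn_ord k; split.
  have -> : a = (U_(i) *+ (n - k) + (b + U_(i) *+ k))%MM.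
    rewrite {1}ab; apply/mnmP => j; rewrite !mnmDE !mulmnE; nia.
  apply: gt_addl; rewrite -mdeg_eq0 mdegMn mdeg1 mul1n; lia.
by rewrite {1}ab !mdegD !mdegMn mdeg1 !mul1n ltn_add2l.
Qed.

(** From this degree on, some exponent is at least [size D]. The successor matters for [d = 0],
    where there is no exponent to find. *)
Definition degree_bound := (d * size D).+1.

Lemma large_degree_coord (a : expo d) : (degree_bound <= mdeg a)%N ->
  exists i : 'I_d, (size D <= a i)%N.
Proof.
move=> Na; apply/existsP; apply: contraLR Na; rewrite negb_exists => /forallP H.
rewrite -ltnNge ltnS mdegE -[d in (d * _)%N]card_ord -sum_nat_const.
by apply: leq_sum => i _; have := H i; rewrite -ltnNge => /ltnW.
Qed.

Lemma in_LD_degree a : in_LD D gt a -> (mdeg a < degree_bound)%N.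
Proof.
move=> Ha; rewrite ltnNge; apply/negP => /large_degree_coord[i /large_coord_reduces r].
by apply: in_LD_irreducible Ha; apply: reduces_weaken r => m [].
Qed.

Definition below (a m : expo d) := m = a \/ gt a m.

Let gt_trans a b c : gt a b -> gt b c -> gt a c.
Proof. by case: gtP => _ + _ _ _; apply. Qed.

Lemma gt_below_trans a b c : gt a b -> below b c -> gt a c.
Proof. by move=> ab [->//|]; apply: gt_trans. Qed.

(** Induction on the degree, which [large_coord_reduces] lowers together with the monomial. *)
Lemma reduces_bounded a :
  reduces (fun m => below a m /\ (mdeg m < degree_bound)%N) 'X_[a].
Proof.
have [k] := ubnP (mdeg a); elim: k a => // k IH a ak.
have [aN|/large_degree_coord[i ai]] := ltnP (mdeg a) degree_bound.
  by apply: reduces_supported; apply: supportedX; split=> //; left.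
apply: reduces_trans (large_coord_reduces ai) _ => m [am ma].
apply: reduces_weaken (IH m _) => [m' [mm' m'N]|]; last first.
  exact: leq_trans ma _.
by split=> //; right; apply: gt_below_trans mm'.
Qed.

(** Termination by counting: each step is followed by a return below [degree_bound], and the number
    [c] of bounded monomials under the current one drops, since the new monomial is no longer
    counted. *)
Lemma normal_form a : reduces (fun m => in_LD D gt m /\ below a m) 'X_[a].
Proof.
pose c (a : expo d) := #|[pred b : 'X_{1..d < degree_bound} | gt a (bmnm b)]|.
have [k] := ubnP (c a); elim: k a => // k IH a ak.
have [aL|/not_in_LD_reduces r] := pselect (in_LD D gt a).
  by apply: reduces_supported; apply: supportedX; split=> //; left.
have {}r : reduces (fun m => gt a m /\ (mdeg m < degree_bound)%N) 'X_[a].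
  apply: reduces_trans r _ => m am; apply: reduces_weaken (reduces_bounded m).
  by move=> m' [mm' ?]; split=> //; apply: gt_below_trans mm'.
apply: reduces_trans r _ => m [am mN]; apply: reduces_weaken (IH m _).
  by move=> m' [? mm']; split=> //; right; apply: gt_below_trans mm'.
rewrite ltnS in ak; apply: leq_trans ak; apply: proper_card; apply/properP; split.
  by apply/subsetP => b; rewrite !inE; apply: gt_trans.
by exists (BMultinom mN); rewrite !inE ?gt_irr.
Qed.

Lemma LD_exists : exists L : model d, forall a, a \in L <-> in_LD D gt a.
Proof.
pose s := [seq bmnm b | b : 'X_{1..d < degree_bound}].
exists [fset a in s | `[< in_LD D gt a >]]%fset => a; rewrite !inE /=.
split=> [/andP[_ /asboolP]//|aL]; apply/andP; split; last exact/asboolP.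
by apply/mapP; exists (BMultinom (in_LD_degree aL)); rewrite ?mem_enum.
Qed.

End Reduction.

(** * Standard monomials as a basis, and their minimality *)

Section StandardMonomials.
Variables (R : realType) (d : nat) (D : design R d).
Variables (gt : expo d -> expo d -> bool) (L : model d).
Hypotheses (uniqD : uniq D) (gtP : term_ordering gt).
Hypothesis LP : forall a, a \in L <-> in_LD D gt a.
Implicit Types (p s : {mpoly R[d]}).

Local Notation pt i := (nth (0 : 'rV[R]_d) D i).
Local Notation mon M j := (nth (0%MM : expo d) (enum_fset M) j).
Local Notation "p @@ x" := (p.@[fun i => x 0 i]) (at level 10).

Lemma monom_atE (x : 'rV[R]_d) a : monom_at x a = ('X_[a] : {mpoly R[d]}) @@ x.
Proof. by rewrite mevalX. Qed.

Lemma meval_supported (M : model d) s (x : 'rV[R]_d) :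
  supported (fun a => a \in M) s ->
  s @@ x = \sum_(a <- M) s@_a * monom_at x a.
Proof.
move=> sM; rewrite mevalE [RHS](bigID (fun a => a \in msupp s)) /= [X in _ = _ + X]big1.
  rewrite addr0 -[RHS]big_filter; apply: perm_big; apply: uniq_perm.
  - exact: msupp_uniq.
  - exact/filter_uniq/fset_uniq.
  - by move=> a; rewrite mem_filter; case: (boolP (a \in _)) => // /sM.
by move=> a /memN_msupp_eq0 ->; rewrite mul0r.
Qed.

Lemma exists_lead p : p != 0 -> exists m, is_lead gt p m.
Proof.
case: gtP => _ gt_trans gt_total _ _; rewrite -msupp_eq0 /is_lead.
elim: (msupp p) => // a s IH _.
have [->|/IH[m [ms lead]]] := eqVneq s [::].
  by exists a; split=> [|m]; rewrite inE // => /eqP->; rewrite eqxx.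
have [E|/gt_total /orP[am|ma]] := eqVneq a m.
- exists a; rewrite mem_head; split=> // m'; rewrite inE => /orP[->//|].
  by rewrite E; apply: lead.
- exists a; rewrite mem_head; split=> // m'; rewrite inE => /orP[->//|m's _].
  have [->//|] := eqVneq m' m; move/(lead _ m's); exact: gt_trans.
- exists m; rewrite inE ms orbT; split=> // m'.
  by rewrite inE => /orP[/eqP->//|]; apply: lead.
Qed.

(** Linear independence on [D]: the leading monomial of a nonzero ideal element is never
    standard. *)
Lemma standard_ideal_eq0 p :
  in_design_ideal D p -> supported (fun a => a \in L) p -> p = 0.
Proof.
move=> Ip pL; apply: contrapT => /eqP p0; have [m lead] := exists_lead p0.
have /LP : m \in L by case: lead => /pL.
by apply; exists p, m; split=> //; apply: exp_le_refl.
Qed.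

Lemma reduces_standard p : reduces D (fun a => a \in L) p.
Proof.
apply: reduces_monomials => a _; have := normal_form D gtP a.
by apply: reduces_weaken => m [/LP].
Qed.

(** Spanning in dual form: by normal forms, a functional that kills the standard monomials kills
    every polynomial, in particular those that isolate one point. *)
Lemma standard_annihilator (u : 'I_(size D) -> R) :
  (forall a, a \in L -> \sum_i u i * monom_at (pt i) a = 0) -> u =1 fun=> 0.
Proof.
move=> uL j.
have u0 p : \sum_i u i * p @@ (pt i) = 0.
  have [s Is sL] := reduces_standard p.
  transitivity (\sum_i u i * s @@ (pt i)).
    apply: eq_bigr => i _; congr (_ * _); apply/eqP.
    by rewrite -subr_eq0 -mevalB Is // mem_nth.
  under eq_bigr => i _ do rewrite (meval_supported _ sL) mulr_sumr.
  rewrite exchange_big big1_seq //= => a aL.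
  under eq_bigr => i _ do rewrite mulrCA.
  by rewrite -mulr_sumr uL ?mulr0.
(* The squared distance to the point [k] vanishes only there, so the product over [k != j] is
   nonzero at the point [j] alone. *)
pose g (k : 'I_(size D)) : {mpoly R[d]} := \sum_i ('X_i - (pt k 0 i)%:MP) ^+ 2.
have gE k x : (g k) @@ x = \sum_i (x 0 i - pt k 0 i) ^+ 2.
  rewrite raddf_sum; apply: eq_bigr => i _.
  by rewrite /= expr2 mevalM mevalB mevalXU mevalC.
have prodE x : (\prod_(k | k != j) g k) @@ x = \prod_(k | k != j) (g k) @@ x.
  by rewrite rmorph_prod.
have := u0 (\prod_(k | k != j) g k); rewrite (bigD1 j) //= [X in _ + X]big1.
  rewrite addr0 => /eqP; rewrite mulf_eq0 prodE => /orP[/eqP//|].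
  move=> /prodf_eq0[k kj]; rewrite gE psumr_eq0 => [/allP E|i _]; last exact: sqr_ge0.
  case/negP: kj; rewrite -val_eqE -(nth_uniq 0 _ _ uniqD) ?ltn_ord //.
  apply/eqP/rowP => i; have /implyP/(_ isT) := E i (mem_index_enum i).
  by rewrite sqrf_eq0 subr_eq0 => /eqP.
move=> i ij; rewrite prodE (bigD1 i) //= gE big1 ?mul0r ?mulr0 // => l _.
by rewrite subrr expr0n.
Qed.

(** The evaluation matrix, still rectangular here, has independent rows by [standard_annihilator]
    and independent columns by [standard_ideal_eq0]. *)
Lemma standard_card : #|` L| = size D.
Proof.
pose E : 'M[R]_(size D, #|` L|) := \matrix_(i, j) monom_at (pt i) (mon L j).
have rE : row_free E.
  apply: inj_row_free => u uE; apply/rowP => i; rewrite mxE.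
  apply: (standard_annihilator (u := fun i => u 0 i)) => a aL.
  have ja : (index a (enum_fset L) < #|` L|)%N by rewrite index_mem.
  have := congr1 (fun v : 'rV__ => v 0 (Ordinal ja)) uE; rewrite !mxE => E0.
  by rewrite -[RHS]E0; apply: eq_bigr => k _; rewrite mxE nth_index.
have cE : row_free E^T.
  apply: inj_row_free => v vE; apply/rowP => j; rewrite mxE.
  pose p : {mpoly R[d]} := \sum_(k < #|` L|) v 0 k *: 'X_[mon L k].
  have p0 : p = 0.
    apply: standard_ideal_eq0 => [x xD|].
      have ix : (index x D < size D)%N by rewrite index_mem.
      have := congr1 (fun v : 'rV__ => v 0 (Ordinal ix)) vE; rewrite !mxE => E0.
      rewrite -[RHS]E0 raddf_sum; apply: eq_bigr => k _.
      by rewrite /= mevalZ !mxE /= nth_index // monom_atE.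
    rewrite /p; elim/big_ind: _ => [||k _]; first exact: supported0.
      exact: supportedD.
    by apply: supportedZ; apply: supportedX; rewrite mem_nth.
  have := congr1 (mcoeff (mon L j)) p0; rewrite mcoeff0 raddf_sum (bigD1 j) //=.
  rewrite mcoeffZ mcoeffX eqxx mulr1 big1 ?addr0 // => k kj.
  rewrite mcoeffZ mcoeffX nth_uniq ?ltn_ord ?fset_uniq //.
  by rewrite val_eqE (negPf kj) mulr0.
by move: rE cE; rewrite /row_free mxrank_tr => /eqP-> /eqP.
Qed.

Lemma standard_identifiable : identifiable D L.
Proof.
split; first exact: standard_card.
suff : row_free (design_matrix D L).
  by rewrite row_free_unit unitmxE unitfE.
apply: inj_row_free => u uE; apply/rowP => i; rewrite mxE.
apply: (standard_annihilator (u := fun i => u 0 i)) => a aL.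
have ja : (index a (enum_fset L) < size D)%N by rewrite -standard_card index_mem.
have := congr1 (fun v : 'rV__ => v 0 (Ordinal ja)) uE; rewrite !mxE => E0.
by rewrite -[RHS]E0; apply: eq_bigr => k _; rewrite mxE nth_index.
Qed.

Lemma standard_Ls : Ls D L.
Proof.
split; last exact: standard_identifiable.
by move=> a b /LP aL ba; apply/LP; apply: in_LD_down ba.
Qed.

(* The normal forms of the monomials of [M] give an invertible change of basis;
   a nonzero term of its Leibniz expansion is the required matching. *)
Lemma standard_matching (M : model d) : identifiable D M ->
  exists sigma : 'S_(size D),
    forall k : 'I_(size D), below gt (mon M (sigma k)) (mon L k).
Proof.
move=> [cardM detM].
have nf (j : 'I_(size D)) : exists s : {mpoly R[d]},
    in_design_ideal D ('X_[mon M j] - s) /\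
    supported (fun a => a \in L /\ below gt (mon M j) a) s.
  have [s Is sL] := normal_form D gtP (mon M j).
  by exists s; split=> // a /sL[/LP].
have [s sP] := choice nf.
pose C : 'M[R]_(size D) := \matrix_(k, j) (s j)@_(mon L k).
have MC : design_matrix D M = design_matrix D L *m C.
  apply/matrixP => i j; rewrite !mxE monom_atE.
  have [Is sL] := sP j; have sL' : supported (fun a => a \in L) (s j).
    by move=> a /sL[].
  have -> : 'X_[mon M j] @@ (pt i) = (s j) @@ (pt i).
    by apply/eqP; rewrite -subr_eq0 -mevalB Is // mem_nth.
  rewrite (meval_supported _ sL') (big_nth 0%MM) [size _]standard_card big_mkord.
  by apply: eq_bigr => k _; rewrite !mxE mulrC.
have detC : \det C != 0.
  by apply: contraNneq detM => C0; rewrite MC det_mulmx C0 mulr0.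
have [sigma sigmaP] : exists sigma : 'S_(size D), \prod_k C k (sigma k) != 0.
  apply: contrapT => H; case/negP: detC; rewrite /determinant big1 // => sigma _.
  have [->|nz] := eqVneq (\prod_k C k (sigma k)) 0; first by rewrite mulr0.
  by case: H; exists sigma.
(* A nonzero entry says that [mon L k] occurs in the normal form of [mon M (sigma k)]. *)
exists sigma => k; move/prodf_neq0: sigmaP => /(_ k isT).
by rewrite mxE -mcoeff_msupp => /(proj2 (sP _))[].
Qed.

Lemma sum_model (M : model d) (f : expo d -> R) : #|` M| = size D ->
  \sum_(a <- M) f a = \sum_(k < size D) f (mon M k).
Proof. by move=> cM; rewrite (big_nth 0%MM) [size _]cM big_mkord. Qed.

Lemma standard_sum_le (M : model d) (f : expo d -> R) : identifiable D M ->
  (forall a b, gt b a -> f a <= f b) ->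
  \sum_(a <- L) f a <= \sum_(a <- M) f a.
Proof.
move=> idM fP; have [sigma sigmaP] := standard_matching idM.
rewrite !sum_model ?standard_card; [|by case: idM..].
rewrite [leRHS](reindex_inj (@perm_inj _ sigma)) /=.
by apply: ler_sum => k _; case: (sigmaP k) => [->|/fP].
Qed.

(** Either some matched pair differs and its term is strict, or [L] is contained in [M] and has the
    same size. Monotonicity is asked only between [L] and [M] because a weight represents [gt] only
    on a finite set. *)
Lemma standard_sum_lt (M : model d) (f : expo d -> R) : identifiable D M ->
  (forall a b, a \in L -> b \in M -> gt b a -> f a < f b) ->
  L = M \/ \sum_(a <- L) f a < \sum_(a <- M) f a.
Proof.
move=> idM fP; have [sigma sigmaP] := standard_matching idM.
have cM : #|` M| = size D by case: idM.
have cL := standard_card.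
have lL (k : 'I_(size D)) : mon L k \in L by apply: mem_nth; rewrite [X in (_ < X)%N]cL.
have lM (k : 'I_(size D)) : mon M k \in M by apply: mem_nth; rewrite [X in (_ < X)%N]cM.
have [E|/existsNP[k kP]] := pselect (forall k : 'I_(size D), mon L k = mon M (sigma k)).
  left; apply/eqP; rewrite eqEfcard cL cM leqnn andbT.
  apply/fsubsetP => a aL.
  have ja : (index a (enum_fset L) < size D)%N by rewrite -cL index_mem.
  by rewrite -(nth_index 0%MM aL) (E (Ordinal ja)).
right; rewrite !sum_model // [ltRHS](reindex_inj (@perm_inj _ sigma)) /=.
rewrite (bigD1 k) // [ltRHS](bigD1 k) //=; apply: ltr_leD.
  by case: (sigmaP k) => [/kP|/fP->].
by apply: ler_sum => i _; case: (sigmaP i) => [->|/fP/ltW->].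
Qed.

End StandardMonomials.

(** * Weights, term orderings and vertices *)

Section Weights.
Variables (R : realType) (d : nat).
Implicit Types (w : 'rV[R]_d) (a b : expo d).

Definition weight w a : R := \sum_(i < d) w 0 i * (a i)%:R.

Lemma weightD w a b : weight w (a + b)%MM = weight w a + weight w b.
Proof.
by rewrite /weight -big_split; apply: eq_bigr => i _; rewrite mnmDE natrD mulrDr.
Qed.

Lemma weight0 w : weight w 0%MM = 0.
Proof. by rewrite /weight big1 // => i _; rewrite mnm0E mulr0. Qed.

Lemma weight_gt0 w a : pos_weight w -> a != 0%MM -> 0 < weight w a.
Proof.
move=> wp a0; rewrite lt_def sumr_ge0 ?andbT => [|i _]; last first.
  by rewrite mulr_ge0 // ltW.
apply: contra_neq a0 => /eqP.
rewrite psumr_eq0 => [/allP H|i _]; last by rewrite mulr_ge0 // ltW.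
apply/mnmP => i; have /implyP/(_ isT) := H i (mem_index_enum i).
by rewrite mulf_eq0 gt_eqF //= pnatr_eq0 mnm0E => /eqP.
Qed.

Lemma wdot_alphabar w (L : model d) :
  wdot w (alphabar R L) = \sum_(a <- L) weight w a.
Proof.
rewrite exchange_big; apply: eq_bigr => i _.
by rewrite mxE mulr_sumr.
Qed.

Lemma aberrationE (D : design R d) w (L : model d) :
  aberration D w L = (size D)%:R^-1 * wdot w (alphabar R L).
Proof. by rewrite wdot_alphabar. Qed.

(** The larger monomial comes first, as in [gt]; breaking ties by the monomial order gives totality
    and leaves [w] weakly monotone. *)
Definition weight_order w b a : bool :=
  (weight w a < weight w b) || (weight w a == weight w b) && (a < b)%O.

Lemma weight_order_term w : pos_weight w -> term_ordering (weight_order w).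
Proof.
move=> wp; rewrite /weight_order; split.
- by move=> a; rewrite !ltxx andbF.
- move=> a b c /orP[ab|/andP[/eqP ab ba]] /orP[bc|/andP[/eqP bc cb]].
  + by rewrite (lt_trans bc).
  + by rewrite bc ab.
  + by rewrite -ab bc.
  + by rewrite bc ab eqxx (lt_trans cb) ?orbT.
- move=> a b; case: (ltgtP (weight w a) (weight w b)) => //= _.
  by case: (ltgtP a b).
- move=> a b c; rewrite !weightD ltrD2r (inj_eq (addIr _)) ltmc_add2l //.
- by move=> a /(weight_gt0 wp); rewrite weight0 => ->.
Qed.

Lemma weight_order_le w a b : weight_order w b a -> weight w a <= weight w b.
Proof. by move=> /orP[/ltW|/andP[/eqP->]]. Qed.

(** Differences of a larger and a smaller monomial form an additive set without zero, to which
    [separating_weight] applies. *)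
Lemma term_ordering_weight (gt : expo d -> expo d -> bool) (S : seq (expo d)) :
  term_ordering gt -> exists2 w, pos_weight w &
    forall a b, a \in S -> b \in S -> gt b a -> weight w a < weight w b.
Proof.
move=> [gt_irr gt_trans _ gtD gt0].
pose diff b a : 'rV[int]_d := \row_i ((b i)%:Z - (a i)%:Z).
pose C v := exists a b, gt b a /\ v = diff b a.
(* Every variable exceeds the monomial 1, so including them forces the weight to be positive. *)
pose S' := 0%MM :: [seq U_(i)%MM | i : 'I_d] ++ S.
pose V := [seq diff p.1 p.2 | p <- [seq p <- allpairs pair S' S' | gt p.1 p.2]].
have [||v|w wP] := @separating_weight R d C V.
- move=> _ _ [a [b [ab ->]]] [a' [b' [ab' ->]]].
  exists (a + a')%MM, (b + b')%MM; split; last first.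
    by apply/rowP => i; rewrite !mxE !mnmDE !PoszD; ring.
  apply: (gt_trans _ (a + b')%MM); first exact: gtD.
  by rewrite ![(a + _)%MM]addmC; apply: gtD.
- move=> [a [b [ab /rowP E]]]; case/negP: (gt_irr a); rewrite -{1}(_ : b = a) //.
  apply/mnmP => i; have := E i; rewrite !mxE => /esym/eqP; rewrite subr_eq0.
  by rewrite eqz_nat => /eqP.
- by move=> /mapP[[b a]]; rewrite mem_filter => /andP[/= ab _ ->]; exists a, b.
have idotE a b : idot w (diff b a) = weight w b - weight w a.
  rewrite /idot /weight -sumrB; apply: eq_bigr => i _.
  by rewrite mxE rmorphB mulrBr !pmulrn.
have gtw a b : a \in S' -> b \in S' -> gt b a -> weight w a < weight w b.
  move=> aS bS ab; rewrite -subr_gt0 -idotE; apply: wP.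
  by apply/mapP; exists (b, a) => //; rewrite mem_filter ab; apply: allpairs_f.
exists w => [i|a b aS bS]; last first.
  by apply: gtw; rewrite inE mem_cat ?aS ?bS !orbT.
have := gtw 0%MM U_(i)%MM; rewrite mem_head weight0 {1}inE mem_cat.
rewrite map_f ?mem_enum // orbT gt0 ?mnm1_eq0 // => /(_ isT isT isT).
rewrite /weight (bigD1 i) //= mnm1E eqxx mulr1 big1 ?addr0 // => j ji.
by rewrite mnm1E eq_sym (negPf ji) mulr0.
Qed.

Lemma conv_strict_min (P : 'rV[R]_d -> Prop) w v :
  (forall u, P u -> u = v \/ wdot w v < wdot w u) ->
  forall x, conv P x -> x = v \/ wdot w v < wdot w x.
Proof.
move=> vP _ [s [t [st sP t0 t1 ->]]].
have {}t1 : \sum_(k < size s) t`_k = 1 by rewrite -t1 (big_nth 0) big_mkord st.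
have {}t0 (k : 'I_(size s)) : 0 <= t`_k by apply/t0/mem_nth; rewrite st.
have {}sP (k : 'I_(size s)) : s`_k = v \/ wdot w v < wdot w s`_k.
  by apply/vP/sP/mem_nth.
have sumv : \sum_(k < size s) t`_k *: v = v by rewrite -scaler_suml t1 scale1r.
have wE : wdot w (\sum_(k < size s) t`_k *: s`_k)
    = \sum_(k < size s) t`_k * wdot w s`_k.
  rewrite /wdot; under [RHS]eq_bigr => k _ do rewrite mulr_sumr.
  rewrite exchange_big; apply: eq_bigr => i _.
  by rewrite summxE mulr_sumr; apply: eq_bigr => k _; rewrite mxE mulrCA.
have wv : wdot w v = \sum_(k < size s) t`_k * wdot w v.
  by rewrite -mulr_suml t1 mul1r.
(* Scaled points are compared, since a point other than [v] with coefficient zero contributes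
   nothing. *)
have [E|/existsNP[k kP]] :=
    pselect (forall k : 'I_(size s), t`_k *: s`_k = t`_k *: v).
  by left; rewrite -[RHS]sumv; apply: eq_bigr => k _; rewrite E.
right; rewrite wE wv (bigD1 k) // [ltRHS](bigD1 k) //=; apply: ltr_leD.
  case: (sP k) => [skv|lt_k]; first by case: kP; rewrite skv.
  rewrite ltr_pM2l // lt_def t0 andbT; apply/eqP => tk0.
  by case: kP; rewrite tk0 !scale0r.
by apply: ler_sum => i _; case: (sP i) => [->//|/ltW]; apply: ler_wpM2l.
Qed.

(** A unique minimiser of a linear form is extreme: a proper mixture attains the minimum only if
    both ends do. *)
Lemma vertex_strict_min (P : 'rV[R]_d -> Prop) w v : P v ->
  (forall u, P u -> u = v \/ wdot w v < wdot w u) -> vertex (conv P) v.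
Proof.
move=> Pv vP; split.
  exists [:: v], [:: 1]; split=> //.
  - by move=> x; rewrite inE => /eqP->.
  - by move=> c; rewrite inE => /eqP->.
  - by rewrite big_seq1.
  - by rewrite big_ord1 scale1r.
move=> x y t /(conv_strict_min vP) xv /(conv_strict_min vP) yv /andP[t0 t1] E.
have wE : wdot w v = t * wdot w x + (1 - t) * wdot w y.
  rewrite {1}E /wdot !mulr_sumr -big_split; apply: eq_bigr => i _ /=.
  by rewrite !mxE; ring.
have {}E : t * (wdot w x - wdot w v) + (1 - t) * (wdot w y - wdot w v) = 0.
  by rewrite wE; ring.
case: xv yv => [xE|xv] [yE|yv]; split=> //; exfalso; move: E;
  rewrite ?xE ?yE ?subrr ?mulr0 ?addr0 ?add0r; apply/eqP; rewrite gt_eqF //.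
- by rewrite mulr_gt0 ?subr_gt0.
- by rewrite mulr_gt0 ?subr_gt0.
- by rewrite addr_gt0 // mulr_gt0 ?subr_gt0.
- by rewrite addr_gt0 // mulr_gt0 ?subr_gt0.
Qed.

End Weights.

Theorem theorem3 (R : realType) (d : nat) (D : design R d) (w : 'rV[R]_d) :
  uniq D -> pos_weight w ->
  (exists astar : 'rV[R]_d,
     [/\ vertex (state_polytope D) astar,
         (exists L0, Ls D L0 /\ aberration D w L0 = (size D)%:R^-1 * wdot w astar),
         (forall L, Ls D L -> (size D)%:R^-1 * wdot w astar <= aberration D w L) &
         (forall Lstar : model d, @alphabar R d Lstar = astar ->
            aberration D w Lstar = (size D)%:R^-1 * wdot w astar)])
  /\
  (forall Lbar, La D Lbar -> vertex (state_polytope D) (@alphabar R d Lbar) ->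
     exists wstar, pos_weight wstar /\
       forall L, La D L -> aberration D wstar Lbar <= aberration D wstar L).
Proof.
move=> uniqD wp.
have minimiser gt (L : model d) : term_ordering gt ->
    (forall a, a \in L <-> in_LD D gt a) ->
    exists2 u, pos_weight u & forall M, La D M ->
      L = M \/ wdot u (alphabar R L) < wdot u (alphabar R M).
  move=> gtP LP.
  (* This box contains the standard monomials of every term ordering, so one [u] serves against the
     whole fan. *)
  have [u up uP] := term_ordering_weight R
    [seq bmnm b | b : 'X_{1..d < degree_bound D}] gtP.
  exists u => // M [gt' [gtP' MP]]; rewrite !wdot_alphabar.
  have box (a : expo d) : (mdeg a < degree_bound D)%N ->
      a \in [seq bmnm b | b : 'X_{1..d < degree_bound D}].
    by move=> aN; apply/mapP; exists (BMultinom aN); rewrite ?mem_enum.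
  apply: (standard_sum_lt uniqD gtP LP (standard_identifiable uniqD gtP' MP)).
  move=> a b /LP aL /MP bM; apply: uP; apply: box.
    exact: in_LD_degree aL.
  exact: in_LD_degree bM.
(* Only weak, as the inverse is 0 for the empty design. *)
have n0 : 0 <= (size D)%:R^-1 :> R by rewrite invr_ge0.
split=> [|L [gt [gtP LP]] _]; last first.
  have [u up uP] := minimiser gt L gtP LP; exists u; split=> // M /uP[->//|LM].
  by rewrite !aberrationE ler_wpM2l // ltW.
have gtP := weight_order_term wp; have [L LP] := LD_exists D gtP.
have LLs := standard_Ls uniqD gtP LP.
(* Since [w] may have ties on the fan, [u] certifies the vertex, while [w] itself gives minimality
   over [Ls D]. *)
have [u up uP] := minimiser _ L gtP LP.
exists (alphabar R L); split.
- apply: (vertex_strict_min (w := u)).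
    by exists L; split=> //; exists (weight_order w).
  by move=> _ [M [/uP[->|LM] ->]]; [left|right].
- by exists L; rewrite aberrationE.
- move=> M [_ idM]; rewrite aberrationE ler_wpM2l // !wdot_alphabar.
  apply: (standard_sum_le uniqD gtP LP idM) => a b; exact: weight_order_le.
- by move=> M <-; rewrite aberrationE.
Qed.
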